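(* Let $\mathcal{S}$ be a semi-ring of subsets of a set $\Omega$. The space $$\mathrm{fa}(\mathcal{S}):=\{\mu:\mathcal{S}\to\mathbb{R}\;:\;\mu\text{ is a signed charge and }|\mu|\text{ is finite}\},$$ with the pointwise vector space operations and the pointwise order, is a Dedekind complete Riesz space.
   Context: A semi-ring $\mathcal{S}$ of subsets of $\Omega$ is a family with $\emptyset\in\mathcal{S}$, closed under finite intersections, and such that for $A,B\in\mathcal{S}$ the set $A\setminus B$ is a finite disjoint union of elements of $\mathcal{S}$. A signed charge on $\mathcal{S}$ is a set function $\mu:\mathcal{S}\to[-\infty,\infty]$ with $\mu(\emptyset)=0$ that avoids at least one of the values $+\infty,-\infty$ and is finitely additive (for finite families of pairwise disjoint elements of $\mathcal{S}$ whose union is in $\mathcal{S}$). The order is $\mu\le\nu\iff\mu(A)\le\nu(A)$ for all $A\in\mathcal{S}$. The variation of $\mu$ is $|\mu|:=\sup\{-\mu,\mu\}$ (least upper bound among signed charges), given explicitly by $|\mu|(A)=\sup_{\Pi}\sum_{C\in\Pi}|\mu(C)|$, where $\Pi$ ranges over all finite partitions of $A$ by elements of $\mathcal{S}$; it is finite if it takes only finite values. A Riesz space is Dedekind complete if every nonempty subset bounded above has a supremum. *)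

(* Defs.v *)
From HB Require Import structures.
From mathcomp Require Import all_boot all_order all_algebra.
From mathcomp Require Import all_classical all_reals all_analysis.

Set Implicit Arguments.
Unset Strict Implicit.
Unset Printing Implicit Defensive.

Import Order.TTheory GRing.Theory Num.Theory.

Local Open Scope classical_set_scope.
Local Open Scope ring_scope.

(* The library structure [semiRingOfSetsType] is not used because it requires
   a pointed carrier, which would exclude the empty set Omega. *)
Record semiring_of_sets (Omega : Type) (S : set (set Omega)) : Prop := {
  semiring_set0 : S set0 ;
  semiring_setI : setI_closed S ;
  semiring_setD : semi_setD_closed S
}.

(* Set functions on S are functions on the subtype [set_type S] (the coercion
   inserted in [S -> _]), so that equality of functions and the pointwise order
   only depend on the values on the elements of S. *)
Section Charge.
Context (R : realType) (Omega : Type) (S : set (set Omega)).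
Local Open Scope ereal_scope.

Definition finitely_additive (mu : S -> \bar R) : Prop :=
  forall (n : nat) (F : 'I_n -> S) (A : S),
    trivIset [set: 'I_n] (fun i => val (F i)) ->
    val A = \bigcup_i val (F i) ->
    mu A = \sum_(i < n) mu (F i).

Record signed_charge (mu : S -> \bar R) : Prop := {
  charge_set0 : forall A : S, val A = set0 -> mu A = 0 ;
  charge_avoid : (forall A : S, mu A != +oo) \/ (forall A : S, mu A != -oo) ;
  charge_additive : finitely_additive mu
}.

(* The empty set may be one of the blocks of P. This does not change
   [semiring_variation mu] as soon as mu vanishes on the empty set. *)
Definition finite_partition (A : S) (P : set S) : Prop :=
  [/\ finite_set P, trivIset P val & \bigcup_(C in P) val C = val A].

Definition semiring_variation (mu : S -> \bar R) (A : S) : \bar R :=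
  ereal_sup [set \sum_(C \in P) `|mu C| | P in finite_partition A].

Definition fa : set (S -> R^o) :=
  [set mu | signed_charge (EFin \o mu) /\
            forall A : S, semiring_variation (EFin \o mu) A \is a fin_num].

Definition le_pointwise (mu nu : S -> R^o) : Prop :=
  forall A : S, (mu A <= nu A)%R.

End Charge.

Arguments fa R {Omega} S.
Arguments le_pointwise R {Omega} S mu nu.

(* W is a subset of an ambient vector space V and carries the vector space
   operations of V. All the order notions are relative to W; in particular
   upper bounds and suprema are taken in W. *)
Section RieszSpace.
Context (R : realType) (V : lmodType R) (le : V -> V -> Prop) (W : set V).

Definition upper_bound_in (B : set V) (m : V) : Prop :=
  W m /\ forall x, B x -> le x m.

Definition supremum_in (B : set V) (m : V) : Prop :=
  upper_bound_in B m /\ forall b, upper_bound_in B b -> le m b.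

Definition lower_bound_in (B : set V) (m : V) : Prop :=
  W m /\ forall x, B x -> le m x.

Definition infimum_in (B : set V) (m : V) : Prop :=
  lower_bound_in B m /\ forall b, lower_bound_in B b -> le b m.

Record riesz_space : Prop := {
  riesz_submod : submod_closed (mem W) ;
  riesz_le_refl : forall x, W x -> le x x ;
  riesz_le_anti : forall x y, W x -> W y -> le x y -> le y x -> x = y ;
  riesz_le_trans : forall x y z, W x -> W y -> W z ->
    le x y -> le y z -> le x z ;
  riesz_leD : forall x y z, W x -> W y -> W z ->
    le x y -> le (x + z) (y + z) ;
  riesz_leZ : forall (a : R) x y, 0 <= a -> W x -> W y ->
    le x y -> le (a *: x) (a *: y) ;
  riesz_sup : forall x y, W x -> W y -> exists z, supremum_in [set x; y] z ;
  riesz_inf : forall x y, W x -> W y -> exists z, infimum_in [set x; y] z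
}.

Definition dedekind_complete : Prop :=
  forall B : set V, B `<=` W -> B !=set0 ->
    (exists m, upper_bound_in B m) -> exists m, supremum_in B m.

End RieszSpace.

(* Main.v *)
Require Import Defs.
From mathcomp Require Import all_boot all_order all_algebra finmap.
From mathcomp Require Import all_classical all_reals all_analysis.

(** The vector space and order axioms of fa(S) are pointwise, so the content
    is the existence of suprema. One construction gives all of them. For a
    nonempty family B in fa(S), put
      m(A) = sup of sum_i g_i(F_i),
    over all finite tilings (F_i) of A by members of S and all choices of an
    element g_i of B for each tile. Any common upper bound nu of B in fa(S)
    satisfies sum_i g_i(F_i) <= sum_i nu(F_i) = nu(A), so m <= nu; and the
    trivial tiling gives g <= m for g in B. It remains to see that m belongs
    to fa(S) as soon as all its values are finite ([charge_join_supremum]).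

    Additivity. Let A be tiled by (T_j). Cutting the tiles F_i of a selection
    along the T_j turns it into selections on the T_j with the same total sum,
    because each g_i is additive; hence m(A) <= sum_j m(T_j). Conversely,
    almost optimal selections on each T_j glue to a selection on A.

    Finite variation. Fix g in B. As m - g >= 0, one has |m| <= (m - g) + |g|
    on each tile, and m - g is additive, so the sums of |m| over the tilings
    of A are at most m(A) - g(A) + |g|(A).

    Finiteness of m is clear if B has an upper bound nu (bounded by nu(A)),
    which gives Dedekind completeness. It also holds for a pair {mu, nu}
    (bounded by |mu|(A) + |nu|(A)), which gives binary suprema, and binary
    infima follow by the symmetry mu |-> - mu.

    Since tilings are cut and glued, they are indexed by arbitrary finite
    types rather than given as sets of blocks; [faP] restates membership in
    fa(S), which is about sets of blocks and extended real sums, in terms of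
    real sums over indexed tilings. *)

Set Implicit Arguments.
Unset Strict Implicit.
Unset Printing Implicit Defensive.

Import Order.TTheory GRing.Theory Num.Theory.

Local Open Scope classical_set_scope.
Local Open Scope ring_scope.

(** * Indexed tilings *)

Section Tilings.
Context (Omega : Type) (S : set (set Omega)).
Implicit Types (A B : S) (I : finType).

(** Unlike a set of blocks, an indexed tiling may repeat the empty tile, so that
    cutting all tiles along a set never merges two of them. *)
Definition tiling I (F : I -> S) A : Prop :=
  trivIset [set: I] (fun i => val (F i)) /\ val A = \bigcup_i val (F i).

Lemma tiling_sub I (F : I -> S) A i : tiling F A -> val (F i) `<=` val A.
Proof. by move=> [_ ->] x Fx; exists i. Qed.

Lemma tiling_unit A : tiling (fun _ : unit => A) A.
Proof.
split; first by move=> [] [].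
by apply/seteqP; split=> [x Ax|x [? _]//]; exists tt.
Qed.

(** The empty tiling makes the value 0 at the empty set an instance of
    additivity. *)
Lemma tiling_empty A : val A = set0 -> tiling (fun i : void => of_void S i) A.
Proof.
move=> A0; split=> [[]//|].
by rewrite A0; apply/seteqP; split=> [x []|x [[]]].
Qed.

Lemma tiling_reindex I (J : finType) (h : J -> I) (F : I -> S) A :
  bijective h -> tiling F A -> tiling (F \o h) A.
Proof.
move=> [k hK kK] [Ft FA]; split.
  by move=> i j _ _ Fij; apply: (can_inj hK); exact: (Ft (h i) (h j)).
rewrite FA; apply/seteqP; split=> x [i _ Fx]; last by exists (h i).
by exists (k i) => //=; rewrite kK.
Qed.

(** Gluing tilings of the tiles of [F]: indexing by a sigma type keeps track of
    the tile from which each piece comes. *)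
Lemma tiling_sigma I (J : I -> finType) (F : I -> S)
    (G : forall i, J i -> S) A :
  tiling F A -> (forall i, tiling (G i) (F i)) ->
  tiling (fun p : {i : I & J i} => G (tag p) (tagged p)) A.
Proof.
move=> FA GF; split=> [[i a] [j b] _ _ /= [x [xa xb]]|].
  have ij : i = j.
    apply: (FA.1 i j) => //; exists x.
    by split; [exact: (tiling_sub (GF i) xa)|exact: (tiling_sub (GF j) xb)].
  subst j; congr existT.
  by apply: ((GF i).1 a b) => //; exists x.
rewrite FA.2; apply/seteqP; split=> [x [i _]|x [[i a] _] Gx].
  by rewrite (GF i).2 => -[a _ Gx]; exists (Tagged J a).
by exists i => //; exact: (tiling_sub (GF i) Gx).
Qed.

Hypothesis hS : semiring_of_sets S.

Definition cap A B : S :=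
  SigSub (mem_set (semiring_setI hS (set_mem (valP A)) (set_mem (valP B)))).

Lemma capC A B : cap A B = cap B A.
Proof. by apply: val_inj; rewrite /= setIC. Qed.

Lemma tiling_cap I (F : I -> S) A B :
  tiling F A -> val B `<=` val A -> tiling (fun i => cap B (F i)) B.
Proof.
move=> FA BA; split=> [i j _ _ [x [[_ Fi] [_ Fj]]]|].
  by apply: (FA.1 i j) => //; exists x.
apply/seteqP; split=> [x Bx|x [i _ []//]].
by have := BA _ Bx; rewrite FA.2 => -[i _ Fx]; exists i.
Qed.

End Tilings.

(** * Membership in fa(S) through indexed tilings *)

Section FiniteVariation.
Context (R : realType) (Omega : Type) (S : set (set Omega)).
Implicit Types (A : S) (mu : S -> R^o) (I : finType).

Definition additive_on_tilings mu : Prop :=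
  forall I (F : I -> S) A, tiling F A -> mu A = \sum_i mu (F i).

Definition variation_bound mu A (K : R) : Prop :=
  forall I (F : I -> S), tiling F A -> \sum_i `|mu (F i)| <= K.

Lemma additive_on_empty mu A :
  additive_on_tilings mu -> val A = set0 -> mu A = 0.
Proof. by move=> muD /tiling_empty/muD ->; rewrite big1 => // -[]. Qed.

Lemma finitely_additiveP mu :
  finitely_additive (EFin \o mu) <-> additive_on_tilings mu.
Proof.
split=> [muD I F A FA|muD n F A Ft FA]; last first.
  by rewrite /= sumEFin; congr EFin; exact: muD.
have [Ft FE] := tiling_reindex (enum_val_bij _) FA.
have := muD _ _ _ Ft FE; rewrite /= sumEFin => -[->].
by rewrite [RHS](reindex _ (onW_bij _ (enum_val_bij _))).
Qed.

(** A finite set of blocks is a tiling indexed by its own elements. *)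
Lemma semiring_variation_le mu A (K : R) : variation_bound mu A K ->
  (semiring_variation (EFin \o mu) A <= K%:E)%E.
Proof.
move=> muK; apply: ge_ereal_sup => _ [P [Pfin Pt PA] <-].
rewrite fsbig_finite//= sumEFin lee_fin big_seq_fsetE/=.
apply: (muK _ (fun C => val C)); split.
  move=> i j _ _ /= Fij; apply: val_inj; apply: Pt => //.
    by have := valP i; rewrite in_fset_set// inE.
  by have := valP j; rewrite in_fset_set// inE.
rewrite -PA; apply/seteqP; split=> [x [C PC Cx]|x [i _ Fx]].
  have Cin : C \in fset_set P by rewrite in_fset_set// inE.
  by exists (FSetSub Cin).
by exists (val i) => //; have := valP i; rewrite in_fset_set// inE.
Qed.

(** The set of tiles is a partition, but passing to it may identify tiles.
    Disjointness only allows this for empty tiles, on which [mu] vanishes; so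
    the nonempty tiles alone give a partition with the same sum. *)
Lemma tiling_le_semiring_variation mu A I (F : I -> S) :
  additive_on_tilings mu -> tiling F A ->
  ((\sum_i `|mu (F i)|)%:E <= semiring_variation (EFin \o mu) A)%E.
Proof.
move=> muD FA; apply: ereal_sup_ubound => /=.
pose D := [set i | val (F i) !=set0].
have Dinj : set_inj D F.
  move=> i j; rewrite !inE => Di Dj Fij; apply: (FA.1 i j) => //.
  by rewrite /= Fij setIid.
exists (F @` D).
  split.
  - exact/finite_image/finite_finset.
  - move=> _ _ [i _ <-] [j _ <-] Fij; congr F.
    exact: (FA.1 i j).
  - rewrite FA.2 bigcup_image; apply/seteqP; split=> x [i _ Fx].
      by exists i.
    by exists i => //; exists x.
rewrite fsbig_image// fsumEFin; last exact: finite_finset.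
congr EFin; rewrite (fsbig_widen _ [set: I])//=; last first.
  move=> i [_ /= /set0P/negP/negPn/eqP Fi0].
  by rewrite (additive_on_empty muD Fi0) normr0.
rewrite (fsbigE (index_enum I)) ?index_enum_uniq//=; last first.
  by move=> i _; rewrite mem_index_enum.
by apply: eq_bigl => i; rewrite in_setT.
Qed.

Lemma faP mu : fa R S mu <->
  additive_on_tilings mu /\ forall A, exists K, variation_bound mu A K.
Proof.
split=> [[[_ _ /finitely_additiveP muD] mufin]|[muD muK]].
  split=> // A; exists (fine (semiring_variation (EFin \o mu) A)) => I F FA.
  by rewrite -lee_fin fineK//; exact: tiling_le_semiring_variation.
split; first split=> [A A0| |].
- by rewrite /= (additive_on_empty muD).
- by left.
- exact/finitely_additiveP.
move=> A; have [K muAK] := muK A.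
rewrite fin_numElt (le_lt_trans (semiring_variation_le muAK)) ?ltry// andbT.
apply: lt_le_trans (tiling_le_semiring_variation muD (tiling_unit A)).
exact: ltNyr.
Qed.

Lemma fa_linear (a : R) mu nu :
  fa R S mu -> fa R S nu -> fa R S (a *: mu + nu).
Proof.
move=> /faP[muD muK] /faP[nuD nuK]; apply/faP; split=> [I F A FA|A].
  rewrite !fctE (muD _ _ _ FA) (nuD _ _ _ FA) scaler_sumr -big_split /=.
  by apply: eq_bigr.
have [[K muAK] [L nuAL]] := (muK A, nuK A).
exists (`|a| * K + L) => I F FA.
apply: le_trans (_ : \sum_i (`|a| * `|mu (F i)| + `|nu (F i)|) <= _).
  by apply: ler_sum => i _; rewrite -normrM; exact: ler_normD.
by rewrite big_split -mulr_sumr lerD ?ler_wpM2l ?muAK ?nuAL.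
Qed.

Lemma fa_0 : fa R S 0.
Proof.
apply/faP; split=> [I F A FA|A]; first by rewrite big1.
by exists 0 => I F FA; rewrite big1// => i _; exact: normr0.
Qed.

Lemma fa_opp mu : fa R S mu -> fa R S (- mu).
Proof.
by move=> mufa; rewrite -scaleN1r -[_ *: mu]addr0; exact: fa_linear fa_0.
Qed.

End FiniteVariation.

(** * Suprema of families of charges *)

Section Join.
Context (R : realType) (Omega : Type) (S : set (set Omega)).
Hypothesis hS : semiring_of_sets S.
Implicit Types (A : S) (mu : S -> R^o) (I : finType).

(** The charges may vary with the tile: this is what makes the supremum of
    these sums additive, whereas a pointwise supremum need not be. *)
Definition selection_sums (B : set (S -> R^o)) A : set R :=
  [set s | exists I (F : I -> S) (g : I -> S -> R^o),
    [/\ tiling F A, forall i, B (g i) & s = \sum_i g i (F i)]].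

Definition charge_join (B : set (S -> R^o)) : S -> R^o :=
  fun A => sup (selection_sums B A).

Lemma selection_sums_unit B A mu : B mu -> selection_sums B A (mu A).
Proof.
move=> Bmu; exists unit, (fun=> A), (fun=> mu); split=> //.
  exact: tiling_unit.
by rewrite big_const card_unit /= addr0.
Qed.

Section SupremumOfFamily.
Variable B : set (S -> R^o).
Hypothesis Bfa : B `<=` fa R S.
Hypothesis Bn0 : B !=set0.
Hypothesis Bub : forall A, has_ubound (selection_sums B A).

Let sumsn0 A : selection_sums B A !=set0.
Proof. by have [mu Bmu] := Bn0; exists (mu A); exact: selection_sums_unit. Qed.

Lemma charge_join_ub mu A : B mu -> mu A <= charge_join B A.
Proof. by move=> Bmu; apply: ub_le_sup => //; exact: selection_sums_unit. Qed.

(** Cut every tile of a selection on [A] along the [T j] and exchange the two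
    sums: for each [j] the pieces inside [T j], with the charges inherited from
    their tiles, form a selection on [T j]. *)
Lemma charge_join_subadditive I (T : I -> S) A :
  tiling T A -> charge_join B A <= \sum_j charge_join B (T j).
Proof.
move=> TA; apply: ge_sup => // _ [J [F [g [FA Bg ->]]]].
have gE i : g i (F i) = \sum_j g i (cap hS (F i) (T j)).
  have [gD _] := (faP _).1 (Bfa (Bg i)).
  exact: gD (tiling_cap hS TA (tiling_sub FA)).
rewrite (eq_bigr _ (fun i _ => gE i)) exchange_big /=.
apply: ler_sum => j _; apply: ub_le_sup => //.
exists J, (fun i => cap hS (F i) (T j)), g; split=> //.
have := tiling_cap hS FA (tiling_sub (i := j) TA).
by congr tiling; apply/funext => i; exact: capC.
Qed.

(** Glue selections on the [T j] that are optimal up to [e / #|I|.+1]. *)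
Lemma charge_join_superadditive I (T : I -> S) A :
  tiling T A -> \sum_j charge_join B (T j) <= charge_join B A.
Proof.
move=> TA; apply/ler_addgt0Pr => e e0.
(* The denominator is a successor to allow an empty [I]. *)
pose d := e / #|I|.+1%:R.
have d0 : 0 < d by rewrite divr_gt0 ?ltr0n.
pose selection := {J : finType & (J -> S) * (J -> S -> R^o)}%type.
have /choice[c cP] j : exists c : selection,
    [/\ tiling (tagged c).1 (T j), forall i, B ((tagged c).2 i) &
        charge_join B (T j) - d <= \sum_i (tagged c).2 i ((tagged c).1 i)].
  have hsup : has_sup (selection_sums B (T j)) by split.
  have [_ [J [F [g [FT Bg ->]]]] /ltW sd] := sup_adherent d0 hsup.
  pose family (J : finType) := ((J -> S) * (J -> S -> R^o))%type.
  by exists (Tagged family (F, g)).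
have de : d *+ #|I| <= e.
  rewrite -[leRHS](@divfK _ #|I|.+1%:R) ?pnatr_eq0// mulr_natr.
  by rewrite ler_wpMn2l// ltW.
rewrite -lerBlDr (le_trans (lerB (lexx _) de))// -sumr_const -sumrB.
have /le_trans-> //: \sum_j (charge_join B (T j) - d) <=
    \sum_j \sum_i (tagged (c j)).2 i ((tagged (c j)).1 i).
  by apply: ler_sum => j _; have [] := cP j.
rewrite (sig_big_dep _ (fun j (i : tag (c j)) => true)
  (fun j i => (tagged (c j)).2 i ((tagged (c j)).1 i)))/=.
apply: ub_le_sup => //; exists {j : I & tag (c j)}.
exists (fun p => (tagged (c (tag p))).1 (tagged p)).
exists (fun p => (tagged (c (tag p))).2 (tagged p)); split=> //.
  apply: (tiling_sigma (G := fun j => (tagged (c j)).1) TA) => j.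
  by have [] := cP j.
by move=> p; have [_ + _] := cP (tag p); apply.
Qed.

(** The join exceeds any fixed [mu] in [B], so its negative part is controlled
    by that of [mu]; this bounds its variation. *)
Lemma charge_join_fa : fa R S (charge_join B).
Proof.
have jD : additive_on_tilings (charge_join B).
  move=> I T A TA; apply/le_anti.
  by rewrite charge_join_subadditive ?charge_join_superadditive.
apply/faP; split=> // A; have [mu Bmu] := Bn0.
have [muD /(_ A)[K muK]] := (faP _).1 (Bfa Bmu).
exists (charge_join B A - mu A + K) => I F FA.
apply: le_trans (_ : \sum_i (charge_join B (F i) - mu (F i) + `|mu (F i)|) <= _).
  apply: ler_sum => i _; rewrite -{1}[charge_join B (F i)](subrK (mu (F i))).
  rewrite (le_trans (ler_normD _ _))// ger0_norm// subr_ge0.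
  exact: charge_join_ub.
by rewrite big_split sumrB -(jD _ _ _ FA) -(muD _ _ _ FA) lerD2l muK.
Qed.

Lemma charge_join_supremum :
  supremum_in (le_pointwise R S) (fa R S) B (charge_join B).
Proof.
split; first by split=> [|mu Bmu A]; [exact: charge_join_fa|exact: charge_join_ub].
move=> nu [/faP[nuD _] Bnu] A; apply: ge_sup => // _ [I [F [g [FA Bg ->]]]].
by rewrite (nuD _ _ _ FA); apply: ler_sum => i _; exact: Bnu.
Qed.

End SupremumOfFamily.

(** No upper bound of the pair is known in advance; the selection sums are
    bounded because each charge of the pair is at most the sum of the two
    absolute values on each tile. *)
Lemma fa_sup2 mu nu : fa R S mu -> fa R S nu ->
  exists la, supremum_in (le_pointwise R S) (fa R S) [set mu; nu] la.
Proof.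
move=> mufa nufa; exists (charge_join [set mu; nu]).
apply: charge_join_supremum => [_ [->|->]//||A]; first by exists mu; left.
have [_ /(_ A)[K muK]] := (faP _).1 mufa.
have [_ /(_ A)[L nuL]] := (faP _).1 nufa.
exists (K + L) => _ [I [F [g [FA Bg ->]]]].
rewrite (le_trans _ (lerD (muK _ _ FA) (nuL _ _ FA)))// -big_split /=.
apply: ler_sum => i _; rewrite (le_trans (ler_norm _))//.
by case: (Bg i) => ->; rewrite ?lerDl ?lerDr.
Qed.

Lemma fa_inf2 mu nu : fa R S mu -> fa R S nu ->
  exists la, infimum_in (le_pointwise R S) (fa R S) [set mu; nu] la.
Proof.
move=> mufa nufa.
have [la [[lafa laub] lalub]] := fa_sup2 (fa_opp mufa) (fa_opp nufa).
exists (- la); split.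
  split; first exact: fa_opp.
  move=> _ [->|->] A; rewrite fctE lerNl.
    by apply: (laub (- mu)); left.
  by apply: (laub (- nu)); right.
move=> be [befa belb] A; rewrite fctE lerNr.
apply: (lalub (- be)); split; first exact: fa_opp.
move=> _ [->|->] C; rewrite !fctE lerN2; apply: belb; [by left|by right].
Qed.

Lemma fa_dedekind_complete : dedekind_complete (le_pointwise R S) (fa R S).
Proof.
move=> B Bfa Bn0 [m [/faP[mD _] Bm]]; exists (charge_join B).
apply: charge_join_supremum => // A.
exists (m A) => _ [I [F [g [FA Bg ->]]]].
by rewrite (mD _ _ _ FA); apply: ler_sum => i _; exact: Bm.
Qed.

End Join.

Theorem theorem4p3 (R : realType) (Omega : Type) (S : set (set Omega))
    (hS : semiring_of_sets S) :
  riesz_space (le_pointwise R S) (fa R S) /\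
  dedekind_complete (le_pointwise R S) (fa R S).
Proof.
split; last exact: fa_dedekind_complete.
split.
- split=> [|a mu nu]; rewrite !inE; [exact: fa_0|exact: fa_linear].
- by move=> mu _ A.
- by move=> mu nu _ _ mn nm; apply/funext => A; apply/le_anti; rewrite mn nm.
- by move=> mu nu la _ _ _ mn nl A; exact: le_trans (mn A) (nl A).
- by move=> mu nu la _ _ _ mn A; rewrite !fctE lerD2r.
- by move=> a mu nu a0 _ _ mn A; rewrite !fctE ler_wpM2l.
- by move=> mu nu; exact: fa_sup2.
- by move=> mu nu; exact: fa_inf2.
Qed.
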